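(* Let $q$ be a prime power and let $L$ be a line of $\mathrm{PG}(5,q)$ in the $K$-orbit $o_9$. Then the hyperplane-orbit distribution of $L$ is $OD_4(L)=[1,\,q^2+q,\,0,\,q^3]$.
   Context: A point $(y_0,\dots,y_5)$ of $\mathrm{PG}(5,q)$ is identified with the nonzero symmetric matrix $\begin{bmatrix} y_0&y_1&y_2\\ y_1&y_3&y_4\\ y_2&y_4&y_5\end{bmatrix}$ up to scalar. $K\cong\mathrm{PGL}(3,q)$ acts by $M\mapsto AMA^T$, $A\in\mathrm{GL}(3,q)$. The orbit $o_9$ is the $K$-orbit of the line $\left\{\begin{bmatrix} x&0&y\\ 0&y&0\\ y&0&0\end{bmatrix}:(x,y)\in\mathrm{PG}(1,q)\right\}$. Hyperplanes correspond to conics of $\mathrm{PG}(2,q)$ (nonzero quadratic forms up to scalar): $\sum_{0\le i\le j\le2}a_{ij}X_iX_j$ corresponds to $a_{00}Y_0+a_{01}Y_1+a_{02}Y_2+a_{11}Y_3+a_{12}Y_4+a_{22}Y_5=0$. $\mathcal H_1,\mathcal H_{2,r},\mathcal H_{2,i},\mathcal H_3$ are the sets of hyperplanes corresponding respectively to double lines (scalar multiples of squares of linear forms), pairs of distinct real lines (products of two non-proportional linear forms over $\mathbb F_q$), pairs of conjugate imaginary lines (scalar multiples of products of two non-proportional linear forms conjugate over $\mathbb F_{q^2}$), and non-singular conics (those with $4a_{00}a_{11}a_{22}+a_{01}a_{02}a_{12}-a_{00}a_{12}^2-a_{11}a_{02}^2-a_{22}a_{01}^2\ne0$). $OD_4(L)=[h_1,h_{2,r},h_{2,i},h_3]$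 lists the numbers of hyperplanes in $\mathcal H_1,\mathcal H_{2,r},\mathcal H_{2,i},\mathcal H_3$ containing $L$. *)

(* Defs.v *)
From HB Require Import structures.
From mathcomp Require Import all_boot all_order all_algebra all_field.
From mathcomp Require Export mpoly.

Set Implicit Arguments.
Unset Strict Implicit.
Unset Printing Implicit Defensive.

Import GRing.Theory.
Local Open Scope ring_scope.

(* Position of Y_k (resp. of a_ij) in the coordinate order
   00, 01, 02, 11, 12, 22 shared by points and quadratic forms. *)
Definition sidx (i j : 'I_3) : 'I_6 :=
  inord (nth 0%N (nth [::] [:: [:: 0; 1; 2]; [:: 1; 3; 4]; [:: 2; 4; 5]]%N i) j).

Definition symmx (F : fieldType) (y : 'rV[F]_6) : 'M[F]_3 :=
  \matrix_(i, j) y 0 (sidx i j).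

(* A projective point is the set of all multiples (0 included) of a nonzero
   vector; lines and hyperplanes of PG(5,q) are sets of points. *)
Definition ppoint (F : finFieldType) (n : nat) (v : 'rV[F]_n) : {set 'rV[F]_n} :=
  [set k *: v | k : F].

Definition pgl_point (F : finFieldType) (A : 'M[F]_3) (P : {set 'rV[F]_6}) :
    {set 'rV[F]_6} :=
  [set y | symmx y \in [set A *m symmx z *m A^T | z in P]].

Definition pgl_image (F : finFieldType) (A : 'M[F]_3)
    (L : {set {set 'rV[F]_6}}) : {set {set 'rV[F]_6}} :=
  [set pgl_point A P | P in L].

Definition o9_matrix (F : fieldType) (x y : F) : 'M[F]_3 :=
  \matrix_(i, j) (nth [::] [:: [:: x; 0; y]; [:: 0; y; 0]; [:: y; 0; 0]] i)`_j.

Definition o9_line (F : finFieldType) : {set {set 'rV[F]_6}} :=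
  [set ppoint v | v : 'rV[F]_6 &
     [exists x : F, exists y : F,
        ((x, y) != (0, 0)) && (symmx v == o9_matrix x y)]].

Definition o9 (F : finFieldType) : {set {set {set 'rV[F]_6}}} :=
  [set pgl_image A (o9_line F) | A : 'M[F]_3 & A \in unitmx].

Definition linform (R : comNzRingType) (c : 'rV[R]_3) : {mpoly R[3]} :=
  \sum_(i < 3) c 0 i *: 'X_i.

Definition qform (R : comNzRingType) (a : 'rV[R]_6) : {mpoly R[3]} :=
  \sum_(i < 3) \sum_(j < 3 | (i <= j)%N) a 0 (sidx i j) *: ('X_i * 'X_j).

Definition proportional (F : finFieldType) (c d : 'rV[F]_3) : bool :=
  [exists k : F, c == k *: d] || [exists k : F, d == k *: c].

Definition double_line (F : finFieldType) (a : 'rV[F]_6) : bool :=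
  [exists k : F, exists c : 'rV[F]_3, qform a == k *: linform c ^+ 2].

Definition real_line_pair (F : finFieldType) (a : 'rV[F]_6) : bool :=
  [exists c : 'rV[F]_3, exists d : 'rV[F]_3,
     ~~ proportional c d && (qform a == linform c * linform d)].

(* With E of order q^2 over F of order q, x |-> x^q is the conjugation of E/F. *)
Definition conj_form (F E : finFieldType) (c : 'rV[E]_3) : 'rV[E]_3 :=
  map_mx (fun x : E => x ^+ #|F|) c.

Definition imaginary_line_pair (F E : finFieldType) (iota : {rmorphism F -> E})
    (a : 'rV[F]_6) : bool :=
  [exists k : F, exists c : 'rV[E]_3,
     ~~ proportional c (conj_form F c) &&
     (qform (map_mx iota a) == iota k *: (linform c * linform (conj_form F c)))].

Definition conic_disc (F : fieldType) (a : 'rV[F]_6) : F :=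
  let A i j := a 0 (sidx (inord i) (inord j)) in
  4 * A 0%N 0%N * A 1%N 1%N * A 2%N 2%N + A 0%N 1%N * A 0%N 2%N * A 1%N 2%N
  - A 0%N 0%N * A 1%N 2%N ^+ 2 - A 1%N 1%N * A 0%N 2%N ^+ 2
  - A 2%N 2%N * A 0%N 1%N ^+ 2.

Definition nonsingular_conic (F : finFieldType) (a : 'rV[F]_6) : bool :=
  conic_disc a != 0.

Definition hyperplane (F : finFieldType) (a : 'rV[F]_6) : {set {set 'rV[F]_6}} :=
  [set ppoint y | y : 'rV[F]_6 & (y != 0) && (\sum_(i < 6) a 0 i * y 0 i == 0)].

Definition hyperplanes_of (F : finFieldType) (C : pred 'rV[F]_6) :
    {set {set {set 'rV[F]_6}}} :=
  [set hyperplane a | a : 'rV[F]_6 & (a != 0) && C a].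

Definition hyperplanes_through (F : finFieldType) (C : pred 'rV[F]_6)
    (L : {set {set 'rV[F]_6}}) : nat :=
  #|[set H in hyperplanes_of C | L \subset H]|.

Definition OD4 (F E : finFieldType) (iota : {rmorphism F -> E})
    (L : {set {set 'rV[F]_6}}) : seq nat :=
  [:: hyperplanes_through (@double_line F) L;
      hyperplanes_through (@real_line_pair F) L;
      hyperplanes_through (imaginary_line_pair iota) L;
      hyperplanes_through (@nonsingular_conic F) L].

(* Main.v *)
Require Import Defs.
From mathcomp Require Import all_boot all_order all_algebra all_field.
From mathcomp Require Import all_fingroup all_solvable ring.

Set Implicit Arguments.
Unset Strict Implicit.
Unset Printing Implicit Defensive.

Import GRing.Theory.
Local Open Scope ring_scope.

(* The action of A on points is dual, for the pairing between points and
   quadratic forms, to the substitution M |-> A^T M A on forms.  Substitution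
   preserves each of the four classes of conics (the discriminant is multiplied
   by (det A)^2), so the hyperplanes through L correspond, class by class, to
   those through the representative line, that is to the conics
     u XY + v (XZ - Y^2) + w YZ + z Z^2.
   Such a conic has discriminant u v w + v^3 - z u^2.  It is a double line iff
   u = v = w = 0, it is never a pair of conjugate imaginary lines since the
   coefficient of X^2 vanishes, and it splits into two distinct real lines in
   all the other singular cases.  Counting coefficient vectors and dividing by
   q - 1 gives the distribution. *)

(** * Case analysis on coordinates and index pairs *)

Lemma sum_ord3 (V : nmodType) (f : 'I_3 -> V) :
  \sum_(i < 3) f i = f (inord 0) + f (inord 1) + f (inord 2).
Proof.
rewrite !big_ord_recr big_ord0 /= add0r.
by congr (f _ + f _ + f _); apply/val_inj; rewrite /= inordK.
Qed.

Lemma forall_ord3 (P : 'I_3 -> Prop) :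
  P (inord 0) -> P (inord 1) -> P (inord 2) -> forall i, P i.
Proof.
move=> P0 P1 P2 i; rewrite -(inord_val i).
by case: i => [[|[|[|i]]] ilt].
Qed.

Lemma forall_ord6 (P : 'I_6 -> Prop) :
  P (inord 0) -> P (inord 1) -> P (inord 2) -> P (inord 3) -> P (inord 4) ->
  P (inord 5) -> forall i, P i.
Proof.
move=> P0 P1 P2 P3 P4 P5 i; rewrite -(inord_val i).
by case: i => [[|[|[|[|[|[|i]]]]]] ilt].
Qed.

Lemma inord_eq n i j : (i <= n)%N -> (j <= n)%N ->
  ((inord i : 'I_n.+1) == inord j) = (i == j).
Proof. by move=> ile jle; rewrite -val_eqE /= !inordK. Qed.

Lemma sidx_inord i j : (i < 3)%N -> (j < 3)%N -> sidx (inord i) (inord j) =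
  inord (nth 0%N
    (nth [::] [:: [:: 0; 1; 2]; [:: 1; 3; 4]; [:: 2; 4; 5]]%N i) j).
Proof. by move=> i3 j3; rewrite /sidx !inordK. Qed.

Lemma sidxC i j : sidx i j = sidx j i.
Proof.
by elim/forall_ord3: i; elim/forall_ord3: j; rewrite !sidx_inord.
Qed.

Lemma sidx_ind (P : 'I_6 -> Prop) :
  (forall i j : 'I_3, (i <= j)%N -> P (sidx i j)) -> forall k, P k.
Proof.
move=> Pij; have P' i j : (i < 3)%N -> (j < 3)%N -> (i <= j)%N ->
    P (sidx (inord i) (inord j)) by move=> *; apply: Pij; rewrite !inordK.
have := (P' 0 0, P' 0 1, P' 0 2, P' 1 1, P' 1 2, P' 2 2)%N.
rewrite !sidx_inord //= => -[[[[[P0 P1] P2] P3] P4] P5].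
by apply: forall_ord6; [apply: P0|apply: P1|apply: P2|apply: P3|apply:
  P4|apply: P5].
Qed.

(** * Quadratic forms as folded matrices, their pairing with points, and substitution *)

Section Fold.
Variable F : fieldType.
Implicit Types (M A B : 'M[F]_3) (a b y : 'rV[F]_6) (c d : 'rV[F]_3).

(* Coefficient vector of the quadratic form [X M X^T]. *)
Definition mxform M : 'rV[F]_6 :=
  \row_k \sum_(p : 'I_3 * 'I_3 | sidx p.1 p.2 == k) M p.1 p.2.

(** The upper triangular representative of the form: unlike the symmetric one it needs no division
    by 2, so characteristic 2 is covered. *)
Definition formmx a : 'M[F]_3 :=
  \matrix_(i, j) if (i <= j)%N then a 0 (sidx i j) else 0.

Definition pairing a y := \sum_(i < 6) a 0 i * y 0 i.

(** The entries of [M] at (i,j) and (j,i) meet the same coordinate of [y], so the incidence pairing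
    is a trace against a symmetric matrix. *)
Lemma pairing_mxform M y : pairing (mxform M) y = \tr (M^T *m symmx y).
Proof.
rewrite /pairing; under eq_bigr do rewrite mxE mulr_suml.
transitivity (\sum_(p : 'I_3 * 'I_3) M p.1 p.2 * y 0 (sidx p.1 p.2)).
  rewrite (partition_big (fun p : 'I_3 * 'I_3 => sidx p.1 p.2) predT) //=.
  by apply: eq_bigr => k _; apply: eq_bigr => p /eqP->.
rewrite -(pair_bigA _ (fun i j => M i j * y 0 (sidx i j))) /= exchange_big.
apply: eq_bigr => j _; rewrite mxE; apply: eq_bigr => i _.
by rewrite !mxE.
Qed.

Lemma pairing_delta a i : pairing a (delta_mx 0 i) = a 0 i.
Proof.
rewrite /pairing (bigD1 i) //= big1 ?mxE ?eqxx ?mulr1 ?addr0 // => j ji.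
by rewrite mxE (negPf ji) andbF mulr0.
Qed.

Lemma pairing_inj a b : pairing a =1 pairing b -> a = b.
Proof. by move=> eq_ab; apply/rowP => i; rewrite -!pairing_delta eq_ab. Qed.

Lemma mxformE M : [/\ mxform M 0 (inord 0) = M (inord 0) (inord 0),
  mxform M 0 (inord 1) = M (inord 0) (inord 1) + M (inord 1) (inord 0),
  mxform M 0 (inord 2) = M (inord 0) (inord 2) + M (inord 2) (inord 0),
  mxform M 0 (inord 3) = M (inord 1) (inord 1) &
  mxform M 0 (inord 4) = M (inord 1) (inord 2) + M (inord 2) (inord 1) /\
  mxform M 0 (inord 5) = M (inord 2) (inord 2)].
Proof.
have mE k : mxform M 0 k =
    \sum_i \sum_j (if sidx i j == k then M i j else 0).
  by rewrite mxE big_mkcond -(pair_bigA _ (fun i j => if sidx i j == k then M i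
    j else 0)).
by rewrite !mE !sum_ord3 !sidx_inord //= !inord_eq //= !addr0 !add0r.
Qed.

Lemma formmxK a : mxform (formmx a) = a.
Proof.
apply/rowP; case: (mxformE (formmx a)) => e0 e1 e2 e3 [e4 e5].
by elim/forall_ord6; rewrite ?(e0, e1, e2, e3, e4, e5) !mxE !sidx_inord //
  !inordK //= ?addr0.
Qed.

Definition form_act A a := mxform (A^T *m formmx a *m A).

Lemma symmxP (S : 'M[F]_3) : S^T = S -> {y | symmx y = S}.
Proof.
move=> symS; have sE i j : S i j = S j i by rewrite -{1}symS mxE.
exists (\row_k nth 0 [:: S (inord 0) (inord 0); S (inord 0) (inord 1);
  S (inord 0) (inord 2); S (inord 1) (inord 1); S (inord 1) (inord 2);
  S (inord 2) (inord 2)] k).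
apply/matrixP => i j; elim/forall_ord3: i; elim/forall_ord3: j.
all: by rewrite !mxE sidx_inord //= inordK //= sE.
Qed.

Lemma symmx_inj : injective (@symmx F).
Proof.
move=> y z /matrixP eq_yz; apply/rowP; elim/sidx_ind => i j _.
by have := eq_yz i j; rewrite !mxE.
Qed.

Lemma symmx_sym y : (symmx y)^T = symmx y.
Proof. by apply/matrixP => i j; rewrite !mxE sidxC. Qed.

Lemma cong_symmx A y : {z | symmx z = A *m symmx y *m A^T}.
Proof. by apply: symmxP; rewrite !trmx_mul trmxK symmx_sym mulmxA. Qed.

(** Cyclicity of the trace moves [A] from the point to the form: [form_act A] is adjoint to the
    action of [A] on points. *)
Lemma pairing_form_act A a y z : symmx z = A *m symmx y *m A^T ->
  pairing (form_act A a) y = pairing a z.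
Proof.
move=> zE; rewrite -{2}(formmxK a) /form_act !pairing_mxform zE.
by rewrite !trmx_mul trmxK !mulmxA [RHS]mxtrace_mulC !mulmxA.
Qed.

(** [formmx (mxform M)] may differ from [M], but both have the same trace against every symmetric
    matrix, and pairings separate forms. Any matrix representing a form may thus be used to compute
    the action. *)
Lemma form_act_mxform A M : form_act A (mxform M) = mxform (A^T *m M *m A).
Proof.
apply: pairing_inj => y; have [z zE] := cong_symmx A y.
rewrite (pairing_form_act _ zE) !pairing_mxform zE.
by rewrite !trmx_mul trmxK !mulmxA [LHS]mxtrace_mulC !mulmxA.
Qed.

Lemma form_actM A B a : form_act A (form_act B a) = form_act (B *m A) a.
Proof. by rewrite {2}/form_act form_act_mxform /form_act trmx_mul !mulmxA. Qed.

Lemma form_act1 a : form_act 1%:M a = a.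
Proof. by rewrite /form_act trmx1 mul1mx mulmx1 formmxK. Qed.

Lemma mxformZ k M : mxform (k *: M) = k *: mxform M.
Proof.
apply/rowP => i; rewrite !mxE mulr_sumr.
by apply: eq_bigr => p _; rewrite mxE.
Qed.

Lemma form_actZ A k a : form_act A (k *: a) = k *: form_act A a.
Proof.
by rewrite -[a]formmxK -mxformZ !form_act_mxform -mxformZ -scalemxAr -scalemxAl.
Qed.

(** The rank one matrix [c^T *m d] represents the product of the linear forms with coefficients [c]
    and [d]. *)
Definition form_mul c d := mxform (c^T *m d).

Lemma form_act_mul A c d :
  form_act A (form_mul c d) = form_mul (c *m A) (d *m A).
Proof. by rewrite form_act_mxform /form_mul trmx_mul !mulmxA. Qed.

End Fold.

(** * Coefficient vectors versus polynomials in three variables *)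

Section Poly.
Variable F : fieldType.

Lemma qform_coef (a : 'rV[F]_6) (i j : 'I_3) : (i <= j)%N ->
  (qform a)@_(U_(i) + U_(j)) = a 0 (sidx i j).
Proof.
move=> ij.
(* The monomials X_k X_l with k <= l are pairwise distinct, so exactly one term of the double sum
   contributes. *)
have UE (k l : 'I_3) : (k <= l)%N ->
    ((U_(k) + U_(l) == U_(i) + U_(j))%MM = (k == i) && (l == j)).
  move=> kl; apply/eqP/andP=> [/mnmP e|[/eqP-> /eqP->]] //.
  have := e (inord 2); have := e (inord 1); have := e (inord 0).
  rewrite !mnmE.
  elim/forall_ord3: i ij {e}; elim/forall_ord3: j;
  elim/forall_ord3: k kl; elim/forall_ord3: l;
  by rewrite !inordK // !inord_eq.
rewrite /qform raddf_sum /= (bigD1 i) //= [X in _ + X]big1 => [|k ki].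
  rewrite addr0 raddf_sum /= (bigD1 j) //= [X in _ + X]big1 => [|l /andP[il
    lj]].
    by rewrite mcoeffZ -mpolyXD mcoeffX UE // !eqxx mulr1 addr0.
  by rewrite mcoeffZ -mpolyXD mcoeffX UE // (negPf lj) andbF mulr0.
rewrite raddf_sum /= big1 // => l kl.
by rewrite mcoeffZ -mpolyXD mcoeffX UE // (negPf ki) mulr0.
Qed.

Lemma qform_inj : injective (@qform F).
Proof.
move=> a b eq_ab; apply/rowP; elim/sidx_ind => i j ij.
by rewrite -!qform_coef // eq_ab.
Qed.

Lemma qformZ k (a : 'rV[F]_6) : qform (k *: a) = k *: qform a.
Proof.
rewrite /qform scaler_sumr; apply: eq_bigr => i _.
rewrite scaler_sumr; apply: eq_bigr => j _.
by rewrite mxE scalerA.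
Qed.

Lemma qform_mul (c d : 'rV[F]_3) :
  qform (form_mul c d) = linform c * linform d.
Proof.
have [e0 e1 e2 e3 [e4 e5]] := mxformE (c^T *m d).
rewrite /qform /form_mul; under eq_bigr do rewrite big_mkcond /=.
rewrite /linform !sum_ord3 !sidx_inord // !inordK //= (e0, e1) (e1, e2) e2 e3
  e4 e5.
have tE i j : (c^T *m d) i j = c 0 i * d 0 j.
  by rewrite mxE big_ord1 !mxE.
rewrite !tE -!mul_mpolyC !mpolyCD !mpolyCM.
ring.
Qed.

End Poly.

(** * The discriminant under substitution *)

Section Disc.
Variable F : fieldType.

Lemma conic_discE (a : 'rV[F]_6) : conic_disc a =
  let b k := a 0 (inord k) in
  4 * b 0%N * b 3%N * b 5%N + b 1%N * b 2%N * b 4%N - b 0%N * b 4%N ^+ 2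
  - b 3%N * b 2%N ^+ 2 - b 5%N * b 1%N ^+ 2.
Proof. by rewrite /conic_disc !sidx_inord. Qed.

Lemma det_mx33 (A : 'M[F]_3) : let a i j := A (inord i) (inord j) in
  \det A = a 0%N 0%N * (a 1%N 1%N * a 2%N 2%N - a 1%N 2%N * a 2%N 1%N)
         - a 0%N 1%N * (a 1%N 0%N * a 2%N 2%N - a 1%N 2%N * a 2%N 0%N)
         + a 0%N 2%N * (a 1%N 0%N * a 2%N 1%N - a 1%N 1%N * a 2%N 0%N).
Proof.
move=> a; have aE i j : A i j = a (val i) (val j) by rewrite /a !inord_val.
rewrite !(expand_det_row _ ord0) !big_ord_recl !big_ord0 /cofactor.
rewrite !(expand_det_row _ ord0) !big_ord_recl !big_ord0 /cofactor !det_mx11.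
rewrite !mxE !aE /= /bump /=; ring.
Qed.

(** [conic_disc] is half the determinant of the polar matrix, which degenerates in characteristic 2.
    The identity is therefore checked by expanding both sides as integer polynomials in the
    entries. *)
Lemma conic_disc_act (A : 'M[F]_3) a :
  conic_disc (form_act A a) = \det A ^+ 2 * conic_disc a.
Proof.
rewrite !conic_discE /= det_mx33 /form_act.
case: (mxformE (A^T *m formmx a *m A)) => -> -> -> -> [-> ->].
have tE i j : (A^T *m formmx a *m A) i j =
    \sum_(k < 3) \sum_(l < 3)
      A k i * (if (k <= l)%N then a 0 (sidx k l) else 0) * A l j.
  rewrite mxE exchange_big; apply: eq_bigr => l _; rewrite mxE mulr_suml.
  by apply: eq_bigr => k _; rewrite !mxE.
rewrite !tE !sum_ord3 !sidx_inord // !inordK //=.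
ring.
Qed.

End Disc.

(** * Invariance of double lines, real line pairs and non-singular conics *)

Section Lines.
Variable F : finFieldType.
Implicit Types (a b : 'rV[F]_6) (A : 'M[F]_3).

Lemma double_lineP a :
  reflect (exists k c, a = k *: form_mul c c) (double_line a).
Proof.
apply: (iffP existsP) => -[k].
  by case/existsP=> c /eqP e; exists k, c; apply: qform_inj;
    rewrite qformZ qform_mul e.
by case=> c ->; exists k; apply/existsP; exists c; rewrite qformZ qform_mul.
Qed.

Lemma real_line_pairP a :
  reflect (exists c d, ~~ proportional c d /\ a = form_mul c d)
          (real_line_pair a).
Proof.
apply: (iffP existsP) => -[c].
  case/existsP=> d /andP[cd /eqP e]; exists c, d; split=> //.
  by apply: qform_inj; rewrite qform_mul e.
by case=> d [cd ->]; exists c; apply/existsP; exists d; rewrite cd qform_mul /=.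
Qed.

Lemma proportional_mulmxr A (c d : 'rV[F]_3) : A \in unitmx ->
  proportional (c *m A) (d *m A) = proportional c d.
Proof.
move=> uA; congr (_ || _); apply: eq_existsb => k;
by rewrite scalemxAl (inj_eq (can_inj (mulmxK uA))).
Qed.

Lemma double_line_act A a : double_line a -> double_line (form_act A a).
Proof.
case/double_lineP=> k [c ->]; apply/double_lineP; exists k, (c *m A).
by rewrite form_actZ form_act_mul.
Qed.

Lemma real_line_pair_act A a : A \in unitmx ->
  real_line_pair a -> real_line_pair (form_act A a).
Proof.
move=> uA /real_line_pairP[c [d [cd ->]]]; apply/real_line_pairP.
by exists (c *m A), (d *m A); rewrite form_act_mul proportional_mulmxr.
Qed.

Lemma nonsingular_conic_act A a : A \in unitmx ->
  nonsingular_conic a -> nonsingular_conic (form_act A a).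
Proof.
rewrite unitmxE unitfE /nonsingular_conic conic_disc_act => uA.
by apply: mulf_neq0; rewrite expf_neq0.
Qed.

Lemma double_lineZ k a : double_line a -> double_line (k *: a).
Proof.
case/double_lineP=> l [c ->]; apply/double_lineP; exists (k * l), c.
by rewrite scalerA.
Qed.

Lemma form_mulZl k (c d : 'rV[F]_3) : form_mul (k *: c) d = k *: form_mul c d.
Proof. by rewrite /form_mul linearZ /= -scalemxAl mxformZ. Qed.

Lemma real_line_pairZ k a : k != 0 ->
  real_line_pair a -> real_line_pair (k *: a).
Proof.
move=> k0 /real_line_pairP[c [d [cd ->]]]; apply/real_line_pairP.
exists (k *: c), d; rewrite form_mulZl; split=> //; apply: contra cd.
case/orP=> /existsP[l /eqP e]; apply/orP; [left|right]; apply/existsP.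
  by exists (k^-1 * l); rewrite -scalerA -e scalerA mulVf // scale1r.
by exists (l * k); rewrite -scalerA -e.
Qed.

Lemma nonsingular_conicZ k a : k != 0 ->
  nonsingular_conic a -> nonsingular_conic (k *: a).
Proof.
rewrite /nonsingular_conic !conic_discE /= => k0; rewrite !mxE.
set d := (X in X != 0 -> _) => d0.
(* The discriminant is homogeneous of degree 3 in the coefficients. *)
apply: contraNneq (mulf_neq0 (expf_neq0 3 k0) d0) => <-.
by apply/eqP; rewrite /d; ring.
Qed.

End Lines.

(** * Conjugation, and invariance of imaginary line pairs *)

Section Imaginary.
Variables (F E : finFieldType) (iota : {rmorphism F -> E}).
Implicit Types (a b : 'rV[F]_6) (A : 'M[F]_3).

(** [F] embeds in [E], so both have the same characteristic p, and the order of [F] is a power of p: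
    the map is an iterated Frobenius. *)
Lemma exprD_cardF (x y : E) : (x + y) ^+ #|F| = x ^+ #|F| + y ^+ #|F|.
Proof.
have [p p_pr charF] := finPcharP F.
have charE : p \in [pchar E] by apply: (rmorph_pchar iota).
apply: exprDn_pchar; rewrite (eq_pnat _ (pcharf_eq charE)) -cardsT.
exact: abelem_pgroup (fin_ring_pchar_abelem charF).
Qed.

(** The entries of [A] come from [F], hence are fixed by the q-th power map, which is additive and
    multiplicative. *)
Lemma conj_form_mul (c : 'rV[E]_3) A :
  conj_form F (c *m map_mx iota A) = conj_form F c *m map_mx iota A.
Proof.
apply/rowP => j; rewrite !mxE.
have z0 : (0 : E) ^+ #|F| = 0 by rewrite expr0n gtn_eqF //; apply/card_gt0P;
  exists 0.
rewrite (big_morph (fun x => x ^+ #|F|) exprD_cardF z0).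
apply: eq_bigr => i _; by rewrite !mxE exprMn -rmorphXn expf_card.
Qed.

Lemma map_mxform (M : 'M[F]_3) :
  map_mx iota (mxform M) = mxform (map_mx iota M).
Proof.
apply/rowP => k; rewrite !mxE rmorph_sum.
by apply: eq_bigr => p _; rewrite mxE.
Qed.

Lemma map_form_act A a :
  map_mx iota (form_act A a) = form_act (map_mx iota A) (map_mx iota a).
Proof.
rewrite map_mxform !map_mxM /= -map_trmx; congr (mxform (_ *m _ *m _)).
apply/matrixP => i j; rewrite !mxE; case: ifP => _; by rewrite ?rmorph0.
Qed.

Lemma imaginary_line_pairP a :
  reflect (exists k c, ~~ proportional c (conj_form F c) /\
             map_mx iota a = iota k *: form_mul c (conj_form F c))
          (imaginary_line_pair iota a).
Proof.
apply: (iffP existsP) => -[k].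
  case/existsP=> c /andP[cd /eqP e]; exists k, c; split=> //.
  by apply: qform_inj; rewrite qformZ qform_mul e.
by case=> c [cd e]; exists k; apply/existsP; exists c;
  rewrite cd e qformZ qform_mul /=.
Qed.

Lemma imaginary_line_pair_act A a : A \in unitmx ->
  imaginary_line_pair iota a -> imaginary_line_pair iota (form_act A a).
Proof.
move=> uA /imaginary_line_pairP[k [c [cd e]]]; apply/imaginary_line_pairP.
exists k, (c *m map_mx iota A).
by rewrite map_form_act e conj_form_mul proportional_mulmxr ?map_unitmx //
  form_actZ form_act_mul.
Qed.

Lemma imaginary_line_pairZ k a :
  imaginary_line_pair iota a -> imaginary_line_pair iota (k *: a).
Proof.
case/imaginary_line_pairP=> l [c [cd e]]; apply/imaginary_line_pairP.
by exists (k * l), c; rewrite map_mxZ e scalerA rmorphM.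
Qed.

End Imaginary.

(** * Hyperplanes as point sets, and reduction to the representative line *)

Section Hyperplanes.
Variable F : finFieldType.
Implicit Types (a b v y z : 'rV[F]_6) (A : 'M[F]_3) (L : {set {set 'rV[F]_6}}).

Lemma pairingZl k a y : pairing (k *: a) y = k * pairing a y.
Proof. by rewrite mulr_sumr; apply: eq_bigr => i _; rewrite mxE mulrA. Qed.

Lemma pairingZr k a y : pairing a (k *: y) = k * pairing a y.
Proof. by rewrite mulr_sumr; apply: eq_bigr => i _; rewrite mxE mulrCA. Qed.

Lemma pairingBr a y z : pairing a (y - z) = pairing a y - pairing a z.
Proof.
by rewrite /pairing -sumrB; apply: eq_bigr => i _; rewrite !mxE mulrBr.
Qed.

(** Equal points [ppoint v] and [ppoint y] contain each other's generators, so [v] and [y] are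
    multiples of each other and incidence does not depend on the generator. *)
Lemma mem_hyperplane a v :
  (ppoint v \in hyperplane a) = (v != 0) && (pairing a v == 0).
Proof.
apply/imsetP/idP => [[y]|va]; last by exists v; rewrite ?inE.
rewrite inE => /andP[y0 ay] e.
have /imsetP[k _ vE] : v \in ppoint y.
  by rewrite -e; apply/imsetP; exists 1; rewrite ?scale1r.
have /imsetP[l _ yE] : y \in ppoint v.
  by rewrite e; apply/imsetP; exists 1; rewrite ?scale1r.
rewrite vE pairingZr /pairing (eqP ay) mulr0 eqxx andbT.
by apply: contra y0 => /eqP k0; rewrite yE vE k0 scaler0.
Qed.

Lemma eq_hyperplaneP a b : a != 0 -> b != 0 ->
  reflect (exists2 k, k != 0 & b = k *: a) (hyperplane b == hyperplane a).
Proof.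
move=> a0 b0; apply: (iffP eqP) => [e|[k k0 ->]]; last first.
  rewrite /hyperplane.
  have -> : [set y : 'rV[F]_6 | (y != 0) && (\sum_(i < 6) (k *: a) 0 i * y 0 i
    == 0)] =
      [set y : 'rV[F]_6 | (y != 0) && (\sum_(i < 6) a 0 i * y 0 i == 0)] => //.
  apply/setP => y; rewrite !inE.
  by rewrite -![\sum_(_ < _) _]/(pairing _ _) pairingZl mulf_eq0 (negPf k0).
have /rV0Pn[i ai] := a0.
have bE : b = (b 0 i / a 0 i) *: a.
  apply/rowP => j; rewrite mxE.
  (* A vector killed by [a] by construction. Equality of the hyperplanes makes [b] kill it too,
     which says that the (i,j) minor of [a] and [b] vanishes. The zero vector is no point and is
     treated apart. *)
  pose y : 'rV[F]_6 := a 0 i *: delta_mx 0 j - a 0 j *: delta_mx 0 i.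
  have yE c : pairing c y = a 0 i * c 0 j - a 0 j * c 0 i.
    by rewrite pairingBr !pairingZr !pairing_delta.
  have ay : pairing a y = 0 by rewrite yE mulrC subrr.
  have /eqP : pairing b y = 0.
    have [->|y0] := eqVneq y 0; first by rewrite -[0](scale0r (0 : 'rV[F]_6))
      pairingZr mul0r.
    by have := mem_hyperplane b y; rewrite e mem_hyperplane y0 ay eqxx =>
      /esym/eqP.
  rewrite yE subr_eq0 => /eqP h; apply: (mulfI ai); rewrite h.
  by rewrite mulrCA mulrA divfK 1?mulrC.
exists (b 0 i / a 0 i) => //.
by apply: contra b0 => /eqP k0; rewrite bE k0 scale0r.
Qed.

(** By [eq_hyperplaneP] the fibres of [hyperplane] on [S] are the classes of nonzero scalar
    multiples, each with q - 1 elements. *)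
Lemma card_hyperplanes (S : {set 'rV[F]_6}) : 0 \notin S ->
  (forall k a, k != 0 -> a \in S -> k *: a \in S) ->
  (#|[set hyperplane a | a in S]| * #|F|.-1)%N = #|S|.
Proof.
move=> S0 SZ; have nz a : a \in S -> a != 0.
  by move=> aS; apply: contraNneq S0 => <-.
rewrite -[RHS]sum1_card (partition_big_imset (@hyperplane F)) /= -sum_nat_const.
apply: eq_bigr => H /imsetP[a aS ->{H}].
rewrite sum1dep_card -(cardsC1 (0 : F)).
rewrite -(card_imset _ (_ : injective (fun k => k *: a))); last first.
  by move=> k l /eqP; rewrite -subr_eq0 -scalerBl scaler_eq0 (negPf (nz _ aS))
    orbF subr_eq0 => /eqP.
apply: eq_card => b; rewrite inE; apply/imsetP/andP => [[k]|[bS]].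
  rewrite !inE => k0 ->; split; first exact: SZ.
  by apply/eq_hyperplaneP; rewrite ?scaler_eq0 ?negb_or ?k0 ?nz //; exists k.
case/eq_hyperplaneP => [||k k0 ->]; rewrite ?nz //.
by exists k; rewrite ?inE.
Qed.

Lemma symmxZ k v : symmx (k *: v) = k *: symmx v.
Proof. by apply/matrixP => i j; rewrite !mxE. Qed.

Lemma pgl_pointE A v z : symmx z = A *m symmx v *m A^T ->
  pgl_point A (ppoint v) = ppoint z.
Proof.
move=> zE; apply/setP => y; rewrite inE.
apply/imsetP/imsetP => [[w /imsetP[k _ ->]]|[k _ ->]].
  rewrite symmxZ -scalemxAr -scalemxAl -zE -symmxZ => /symmx_inj ->.
  by exists k.
exists (k *: v); first by apply/imsetP; exists k.
by rewrite !symmxZ -scalemxAr -scalemxAl -zE.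
Qed.

(** The equations a_00 = 0 and a_02 + a_11 = 0 of the hyperplanes through [o9_line]; see
    [pairing_o9]. *)
Definition o9_form a := (a 0 (inord 0) == 0) && (a 0 (inord 2) + a 0 (inord 3)
  == 0).

Lemma o9_formZ k a : o9_form a -> o9_form (k *: a).
Proof.
by rewrite /o9_form !mxE -mulrDr => /andP[/eqP-> /eqP->]; rewrite !mulr0 eqxx.
Qed.

Lemma pairing_o9 a v (x y : F) : symmx v = o9_matrix x y ->
  pairing a v = x * a 0 (inord 0) + y * (a 0 (inord 2) + a 0 (inord 3)).
Proof.
move=> vE; rewrite -{1}[a]formmxK pairing_mxform vE /mxtrace sum_ord3 !mxE
  !sum_ord3.
by rewrite !mxE !sidx_inord // !inordK //=; ring.
Qed.

Lemma symmx_o9 (x y : F) : {v | symmx v = o9_matrix x y :> 'M[F]_3}.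
Proof.
apply: symmxP; apply/matrixP => i j; rewrite !mxE.
by elim/forall_ord3: i; elim/forall_ord3: j; rewrite !inordK.
Qed.

Lemma o9_matrix_eq0 (x y : F) : (o9_matrix x y == 0) = ((x, y) == (0, 0)).
Proof.
apply/eqP/eqP => [/matrixP e|[-> ->]].
  have := e (inord 0) (inord 0); have := e (inord 1) (inord 1).
  by rewrite !mxE !inordK //= => -> ->.
apply/matrixP => i j; rewrite !mxE.
by elim/forall_ord3: i; elim/forall_ord3: j; rewrite !inordK.
Qed.

Lemma symmx_eq0 v : (symmx v == 0) = (v == 0).
Proof.
have s0 : symmx (0 : 'rV[F]_6) = 0 by apply/matrixP => i j; rewrite !mxE.
by rewrite -s0 (inj_eq (@symmx_inj F)).
Qed.

(** Adjointness turns incidence with the image line into incidence with the representative line,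
    where the points (1,0) and (0,1) yield the two equations. *)
Lemma sub_hyperplane A a : A \in unitmx ->
  (pgl_image A (o9_line F) \subset hyperplane a) = o9_form (form_act A a).
Proof.
move=> uA; apply/subsetP/idP => [sub|/andP[/eqP b0 /eqP b23] P].
  have h (x y : F) : (x, y) != (0, 0) -> x * (form_act A a) 0 (inord 0) +
      y * ((form_act A a) 0 (inord 2) + (form_act A a) 0 (inord 3)) = 0.
    move=> xy; have [v vE] := symmx_o9 x y.
    have [z zE] := cong_symmx A v.
    rewrite -(pairing_o9 _ vE) (pairing_form_act _ zE); apply/eqP.
    suff: ppoint z \in hyperplane a by rewrite mem_hyperplane => /andP[].
    apply: sub; rewrite -(pgl_pointE zE); apply: imset_f; apply: imset_f.
    by rewrite inE; apply/existsP; exists x; apply/existsP; exists y;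
      rewrite xy vE /=.
  have := h 1 0; have := h 0 1.
  rewrite !mul0r !mul1r add0r addr0 !xpair_eqE eqxx oner_eq0.
  by move=> h1 h2; rewrite /o9_form h1 ?h2 // eqxx.
case/imsetP=> Q /imsetP[v]; rewrite inE.
move=> /existsP[x /existsP[y /andP[xy /eqP vE]]] -> ->{P Q}.
have [z zE] := cong_symmx A v.
rewrite (pgl_pointE zE) mem_hyperplane -(pairing_form_act _ zE) (pairing_o9 _
  vE).
rewrite b0 b23 !mulr0 addr0 eqxx andbT -symmx_eq0 zE.
apply: contra xy; rewrite -o9_matrix_eq0 -vE => /eqP e.
(* Invertibility of [A] recovers [symmx v] from its image, so the image vector is nonzero and spans
   a genuine point. *)
have -> : symmx v = invmx A *m (A *m symmx v *m A^T) *m invmx A^T.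
  by rewrite !mulmxA mulVmx // mul1mx mulmxK ?unitmx_tr.
by rewrite e mulmx0 mul0mx.
Qed.

(** [form_act A] is a bijection preserving [C], so coefficient vectors of hyperplanes through [L]
    may be counted on the representative line; each hyperplane accounts for q - 1 of them. *)
Lemma hyperplanes_through_o9 (C : pred 'rV[F]_6) L : L \in o9 F ->
  (forall A a, A \in unitmx -> C a -> C (form_act A a)) ->
  (forall k a, k != 0 -> C a -> C (k *: a)) ->
  (hyperplanes_through C L * #|F|.-1)%N =
    #|[set b | [&& b != 0, C b & o9_form b]]|.
Proof.
case/imsetP=> A; rewrite inE => uA -> CA CZ.
have act0 B : form_act B (0 : 'rV[F]_6) = 0.
  by rewrite -[X in form_act _ X](scale0r (0 : 'rV[F]_6)) form_actZ scale0r.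
have actK : cancel (@form_act F A) (@form_act F (invmx A)).
  by move=> a; rewrite form_actM mulmxV // form_act1.
have actVK : cancel (@form_act F (invmx A)) (@form_act F A).
  by move=> a; rewrite form_actM mulVmx // form_act1.
have actC a : C (form_act A a) = C a.
  by apply/idP/idP; [rewrite -{2}[a]actK|]; apply: CA; rewrite ?unitmx_inv.
set S := [set a | [&& a != 0, C a & o9_form (form_act A a)]].
transitivity #|S|.
  rewrite -card_hyperplanes; first 1 last.
  - by rewrite inE eqxx.
  - move=> k a k0; rewrite !inE scaler_eq0 negb_or k0 /= => /and3P[-> Ca].
    by rewrite CZ //= form_actZ => /o9_formZ->.
  congr (_ * _)%N; rewrite /hyperplanes_through; apply: eq_card => H.
  rewrite inE; apply/andP/imsetP => [[/imsetP[a]]|[a]].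
    rewrite inE => /andP[a0 Ca] ->; rewrite sub_hyperplane // => o9a.
    by exists a; rewrite // inE a0 Ca.
  rewrite inE => /and3P[a0 Ca o9a] ->; rewrite sub_hyperplane //; split=> //.
  by apply/imsetP; exists a; rewrite // inE a0.
rewrite -(card_imset _ (can_inj actK)); apply: eq_card => b.
apply/imsetP/idP => [[a]|].
  rewrite !inE => /and3P[a0 Ca o9a] ->; rewrite actC Ca o9a !andbT.
  by apply: contra a0 => /eqP e; rewrite -[a]actK e act0.
rewrite inE => /and3P[b0 Cb o9b]; exists (form_act (invmx A) b);
  rewrite ?actVK //.
rewrite inE -actC !actVK Cb o9b !andbT.
by apply: contra b0 => /eqP e; rewrite -[b]actVK e act0.
Qed.

End Hyperplanes.

(** * Classification of the conics attached to the representative line *)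

Section Count.
Variable F : finFieldType.
Implicit Types (b : 'rV[F]_6) (c d : 'rV[F]_3) (u v w z : F).

Lemma form_mulE c d : let f := form_mul c d in
  let x i := c 0 (inord i) in let y i := d 0 (inord i) in
  [/\ f 0 (inord 0) = x 0%N * y 0%N,
      f 0 (inord 1) = x 0%N * y 1%N + x 1%N * y 0%N,
      f 0 (inord 2) = x 0%N * y 2%N + x 2%N * y 0%N,
      f 0 (inord 3) = x 1%N * y 1%N &
      f 0 (inord 4) = x 1%N * y 2%N + x 2%N * y 1%N /\
      f 0 (inord 5) = x 2%N * y 2%N].
Proof.
have tE i j : (c^T *m d) i j = c 0 i * d 0 j by rewrite mxE big_ord1 !mxE.
by have := mxformE (c^T *m d); rewrite !tE.
Qed.

Lemma proportional_minors c d :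
  (forall i j, c 0 i * d 0 j = c 0 j * d 0 i) -> proportional c d.
Proof.
move=> cd; have [->|c0] := eqVneq c 0.
  by apply/orP; left; apply/existsP; exists 0; rewrite scale0r.
have /rV0Pn[i ci] := c0.
apply/orP; right; apply/existsP; exists (d 0 i / c 0 i); apply/eqP/rowP => j.
by apply: (mulfI ci); rewrite cd mxE mulrA mulrCA divff // mulr1 mulrC.
Qed.

(* The conics [u XY + v (XZ - Y^2) + w YZ + z Z^2]. *)
Definition o9_conic u v w z : 'rV[F]_6 :=
  \row_k nth 0 [:: 0; u; v; - v; w; z] k.

Lemma o9_conicE u v w z : let b := o9_conic u v w z in
  [/\ b 0 (inord 0) = 0, b 0 (inord 1) = u, b 0 (inord 2) = v,
      b 0 (inord 3) = - v & b 0 (inord 4) = w /\ b 0 (inord 5) = z].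
Proof. by split; rewrite ?mxE ?inordK //; split; rewrite mxE inordK. Qed.

Lemma o9_form_conic u v w z : o9_form (o9_conic u v w z).
Proof.
by case: (o9_conicE u v w z) => b0 _ b2 b3 _;
  rewrite /o9_form b0 b2 b3 subrr eqxx.
Qed.

Lemma o9_formE b : o9_form b -> b =
  o9_conic (b 0 (inord 1)) (b 0 (inord 2)) (b 0 (inord 4)) (b 0 (inord 5)).
Proof.
case/andP=> /eqP b0; rewrite addrC addr_eq0 => /eqP b3.
by apply/rowP; elim/forall_ord6; rewrite mxE inordK.
Qed.

Lemma o9_conic_inj u v w z u' v' w' z' :
  o9_conic u v w z = o9_conic u' v' w' z' ->
  [/\ u = u', v = v', w = w' & z = z'].
Proof.
move=> e; case: (o9_conicE u v w z); rewrite e.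
by case: (o9_conicE u' v' w' z') => _ -> -> _ [-> ->] _ -> -> _ [-> ->].
Qed.

Lemma disc_o9_conic u v w z :
  conic_disc (o9_conic u v w z) = u * v * w + v ^+ 3 - z * u ^+ 2.
Proof.
rewrite conic_discE /=; case: (o9_conicE u v w z) => -> -> -> -> [-> ->]; ring.
Qed.

(** In k c^2 the missing X^2 term forces c_0 = 0. This kills the XY and XZ terms, so u = v = 0; then
    the Y^2 term -v vanishes, c_1 = 0, and w = 0. *)
Lemma double_line_o9 u v w z : o9_conic u v w z != 0 ->
  double_line (o9_conic u v w z) = [&& u == 0, v == 0 & w == 0].
Proof.
move=> b0; apply/double_lineP/and3P => [[k [c e]]|[/eqP-> /eqP-> /eqP->]];
  last first.
  (* The remaining conic is z Z^2. *)
  exists z, (delta_mx 0 (inord 2)).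
  have [e0 e1 e2 e3 [e4 e5]] := form_mulE (delta_mx 0 (inord 2)) (delta_mx 0
    (inord 2)).
  apply/rowP; elim/forall_ord6; rewrite [LHS]mxE inordK // [RHS]mxE;
  by rewrite ?(e0, e1, e2, e3, e4, e5) !mxE !inord_eq //= ?(mulr0, mul0r,
    mulr1, addr0, oppr0).
have k0 : k != 0 by apply: contra b0 => /eqP k0; rewrite e k0 scale0r.
have [f0 f1 f2 f3 [f4 f5]] := form_mulE c c.
have kE (a : 'rV[F]_6) i : (k *: a) 0 i = k * a 0 i by rewrite mxE.
have [] := o9_conicE u v w z; rewrite e !kE f0 f1 f2 f3 f4.
move=> /eqP; rewrite !mulf_eq0 (negPf k0) orbb => /eqP -> <- <-.
rewrite !(mul0r, mulr0, addr0) oppr0 => /eqP.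
by rewrite !mulf_eq0 (negPf k0) orbb => /eqP -> [<- _];
  rewrite !(mul0r, mulr0, addr0) eqxx.
Qed.

(** A vanishing product kills one of the two cross terms, hence also the other. Applied to the
    coefficients of two linear forms, it isolates the products c_i d_j. *)
Lemma mul_cross0 (x y x' y' : F) : x * y = 0 -> x * y' + x' * y = 0 ->
  x * y' = 0 /\ x' * y = 0.
Proof.
by move=> /eqP; rewrite mulf_eq0 => /orP[] /eqP ->;
  rewrite !(mul0r, mulr0, add0r, addr0).
Qed.

(** The discriminant of a product of linear forms vanishes identically; if also u = v = w = 0, all
    mixed products c_i d_j vanish and the lines coincide. Conversely, an explicit factorisation is
    given according to whether u = 0. *)
Lemma real_line_pair_o9 u v w z :
  real_line_pair (o9_conic u v w z) =
  (u * v * w + v ^+ 3 - z * u ^+ 2 == 0) && ~~ [&& u == 0, v == 0 & w == 0].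
Proof.
apply/real_line_pairP/andP => [[c [d [cd e]]]|[]].
  have [f0 f1 f2 f3 [f4 f5]] := form_mulE c d; split.
    rewrite -disc_o9_conic e conic_discE /= f0 f1 f2 f3 f4 f5; apply/eqP; ring.
  have [] := o9_conicE u v w z; rewrite e f0 f1 f2 f3 f4 => g0 g1 g2 g3 [g4 _].
  apply: contra cd => /and3P[/eqP u0 /eqP v0 /eqP w0].
  move: g1 g2 g3 g4; rewrite u0 v0 w0 oppr0.
  move=> /(mul_cross0 g0)[h01 h10] /(mul_cross0 g0)[h02 h20].
  move=> g3 /(mul_cross0 g3)[h12 h21].
  apply: proportional_minors => i j.
  by elim/forall_ord3: i; elim/forall_ord3: j;
    rewrite ?h01 ?h02 ?h12 ?h10 ?h20 ?h21.
pose lin (x y t : F) : 'rV[F]_3 := \row_k nth 0 [:: x; y; t] k.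
have linE x y t : [/\ lin x y t 0 (inord 0) = x, lin x y t 0 (inord 1) = y
    & lin x y t 0 (inord 2) = t] by split; rewrite mxE inordK.
have [->{u} | u0 disc _] := eqVneq u 0.
  (* For u = 0 the discriminant is v^3, so v = 0 and the conic is Z (w Y + z Z) with w nonzero. *)
  rewrite !mul0r expr0n mulr0 subr0 add0r expf_eq0 /= => /eqP ->.
  rewrite eqxx /= => w0.
  exists (lin 0 0 1), (lin 0 w z); split.
    apply/negP => /orP[] /existsP[k /eqP/rowP e].
      have := e (inord 1); have := e (inord 2); rewrite !mxE !inordK //= => h.
      move/esym/eqP; rewrite mulf_eq0 (negPf w0) orbF => /eqP k0.
      by move/eqP: h; rewrite k0 mul0r oner_eq0.
    by have /eqP := e (inord 1); rewrite !mxE !inordK //= mulr0 (negPf w0).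
  have [f0 f1 f2 f3 [f4 f5]] := form_mulE (lin 0 0 1) (lin 0 w z).
  have [l0 l1 l2] := linE 0 0 1; have [m0 m1 m2] := linE 0 w z.
  apply/rowP; elim/forall_ord6; rewrite [LHS]mxE inordK //=.
  - by rewrite f0 l0 mul0r.
  - by rewrite f1 l0 l1 !mul0r addr0.
  - by rewrite f2 l0 m0 mul0r mulr0 addr0.
  - by rewrite f3 l1 mul0r oppr0.
  - by rewrite f4 l1 l2 m1 mul0r mul1r add0r.
  - by rewrite f5 l2 m2 mul1r.
(* For u nonzero the conic is (Y + t Z)(u X - v Y + (w + v t) Z): the XZ term gives t = v / u, the
   YZ term gives the last coefficient, and the Z^2 term is the vanishing of the discriminant. *)
pose t := v / u.
exists (lin 0 1 t), (lin u (- v) (w + v * t)); split.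
  apply/negP => /orP[] /existsP[k /eqP/rowP e]; have := e (inord 0).
    have := e (inord 1); rewrite !mxE !inordK //= => h.
    move/esym/eqP; rewrite mulf_eq0 (negPf u0) orbF => /eqP k0.
    by move/eqP: h; rewrite k0 mul0r oner_eq0.
  by rewrite !mxE !inordK //= mulr0 => /eqP; rewrite (negPf u0).
have [f0 f1 f2 f3 [f4 f5]] := form_mulE (lin 0 1 t) (lin u (- v) (w + v * t)).
have [l0 l1 l2] := linE 0 1 t; have [m0 m1 m2] := linE u (- v) (w + v * t).
have tu : t * u = v by rewrite divfK.
apply/rowP; elim/forall_ord6; rewrite [LHS]mxE inordK //=.
- by rewrite f0 l0 mul0r.
- by rewrite f1 l0 l1 m0 mul0r mul1r add0r.
- by rewrite f2 l0 l2 m0 mul0r tu add0r.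
- by rewrite f3 l1 m1 mul1r.
- by rewrite f4 l1 l2 m1 m2 mul1r mulrN [t * v]mulrC addrK.
rewrite f5 l2 m2; apply: (mulfI (expf_neq0 2 u0)).
move: disc; rewrite subr_eq0 [LHS]mulrC => /eqP <-.
by rewrite -tu; ring.
Qed.

End Count.

(** A coefficient times its conjugate is a power of it, so it vanishes only with the coefficient.
    Thus a_00 = 0 gives c_0 = 0, then v = a_02 = 0, then a_11 = -v = 0 gives c_1 = 0. The form c is
    then a multiple of Z, hence proportional to its conjugate. *)
Lemma imaginary_line_pair_o9 (F E : finFieldType) (iota : {rmorphism F -> E})
    (u v w z : F) : o9_conic u v w z != 0 ->
  imaginary_line_pair iota (o9_conic u v w z) = false.
Proof.
move=> b0; case: imaginary_line_pairP => // -[k [c [cd e]]].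
have k0 : iota k != 0.
  apply: contra b0 => /eqP k0; apply/eqP/(map_mx_inj (f := iota)).
  by rewrite e k0 scale0r map_mx0.
have coef i : iota (o9_conic u v w z 0 i) =
    iota k * form_mul c (conj_form F c) 0 i.
  by have /rowP/(_ i) := e; rewrite !mxE.
have [f0 f1 f2 f3 _] := form_mulE c (conj_form F c).
have [g0 _ g2 g3 _] := o9_conicE u v w z.
have conjE i : c 0 i = 0 -> conj_form F c 0 i = 0.
  by move=> c0; rewrite mxE c0 expr0n gtn_eqF //; apply/card_gt0P; exists 0.
have sq0 i : c 0 i * conj_form F c 0 i = 0 -> c 0 i = 0.
  by move=> /eqP; rewrite mxE -exprS expf_eq0 => /eqP.
have c0 : c 0 (inord 0) = 0.
  apply: sq0; rewrite -f0; apply: (mulfI k0).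
  by rewrite -coef g0 rmorph0 mulr0.
have v0 : v = 0.
  apply: (fmorph_inj iota); rewrite -g2 coef f2 (conjE _ c0) c0.
  by rewrite mul0r mulr0 addr0 mulr0 rmorph0.
have c1 : c 0 (inord 1) = 0.
  apply: sq0; rewrite -f3; apply: (mulfI k0).
  by rewrite -coef g3 v0 oppr0 rmorph0 mulr0.
case/negP: cd; apply: proportional_minors => i j.
elim/forall_ord3: i; elim/forall_ord3: j => //;
by rewrite ?(conjE _ c0) ?(conjE _ c1) ?c0 ?c1 ?mul0r ?mulr0.
Qed.

(** * Counting coefficient vectors in each class *)

Section Cards.
Variable F : finFieldType.
Local Notation q := #|F|.

Lemma card_double_o9 :
  #|[set b : 'rV[F]_6 | [&& b != 0, double_line b & o9_form b]]| = q.-1.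
Proof.
rewrite -(cardsC1 (0 : F)) -(card_imset _ (_ : injective (o9_conic 0 0 0)));
  last first.
  by move=> z z' /o9_conic_inj[].
apply: eq_card => b; rewrite inE; apply/and3P/imsetP => [[b0 Db /o9_formE
  e]|[z]].
  move: Db b0; rewrite e => Db b0; move: Db.
  rewrite double_line_o9 // => /and3P[/eqP u0 /eqP v0 /eqP w0].
  move: b0; rewrite u0 v0 w0 => b0.
  exists (b 0 (inord 5)); rewrite // !inE; apply: contra b0 => /eqP ->.
  by apply/eqP/rowP; elim/forall_ord6; rewrite !mxE !inordK //= oppr0.
rewrite !inE => z0 ->.
have b0 : o9_conic 0 0 0 z != 0.
  apply: contra z0 => /eqP/rowP/(_ (inord 5)).
  by case: (o9_conicE 0 0 0 z) => _ _ _ _ [_ ->]; rewrite mxE => ->.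
by rewrite double_line_o9 // !eqxx o9_form_conic.
Qed.

Lemma o9_conic_neq0 (u v w z : F) :
  ~~ [&& u == 0, v == 0 & w == 0] -> o9_conic u v w z != 0.
Proof.
apply: contra => /eqP/rowP e.
case: (o9_conicE u v w z); rewrite !e !mxE => _ <- <- _ [<- _].
by rewrite eqxx.
Qed.

(** The discriminant has degree 1 in z exactly when u is nonzero, so the cases u = 0 and u nonzero
    are counted separately. *)
Lemma card_o9_split (P : pred 'rV[F]_6) :
  #|[set b | P b && o9_form b]| =
  (#|[set p : F * F * F | P (o9_conic 0%R p.1.1 p.1.2 p.2)]| +
   #|[set p : F * F * F * F | (p.1.1.1 != 0%R) &&
       P (o9_conic p.1.1.1 p.1.1.2 p.1.2 p.2)]|)%N.
Proof.
rewrite -(cardsID [set b : 'rV[F]_6 | b 0 (inord 1) == 0]); congr (_ + _)%N.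
  rewrite -(card_imset _ (_ : injective (fun p : F * F * F => o9_conic 0 p.1.1
    p.1.2 p.2))).
    apply: eq_card => b; rewrite !inE; apply/andP/imsetP => [[/andP[Pb ob] /eqP
      b1]|[p]].
      exists (b 0 (inord 2), b 0 (inord 4), b 0 (inord 5));
        last by rewrite /= -b1 -o9_formE.
      by rewrite inE /= -b1 -o9_formE.
    rewrite inE => Pp ->; rewrite Pp o9_form_conic.
    by case: (o9_conicE 0 p.1.1 p.1.2 p.2) => _ -> _ _ _; rewrite eqxx.
  by move=> [[v w] z] [[v' w'] z'] /o9_conic_inj /= [_ -> -> ->].
rewrite -(card_imset _ (_ : injective (fun p : F * F * F * F => o9_conic
  p.1.1.1 p.1.1.2 p.1.2 p.2))).
  apply: eq_card => b; rewrite !inE; apply/andP/imsetP => [[b1 /andP[Pb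
    ob]]|[p]].
    exists (b 0 (inord 1), b 0 (inord 2), b 0 (inord 4), b 0 (inord 5));
      last by rewrite /= -o9_formE.
    by rewrite inE /= -o9_formE ?b1.
  rewrite inE => /andP[p0 Pp] ->; rewrite Pp o9_form_conic.
  by case: (o9_conicE p.1.1.1 p.1.1.2 p.1.2 p.2) => _ -> _ _ _.
by move=> [[[u v] w] z] [[[u' v'] w'] z'] /o9_conic_inj /= [-> -> -> ->].
Qed.

Lemma card_real_o9 :
  #|[set b : 'rV[F]_6 | [&& b != 0, real_line_pair b & o9_form b]]| =
  (q.-1 * q + q.-1 * q * q)%N.
Proof.
transitivity #|[set b : 'rV[F]_6 | real_line_pair b && o9_form b]|.
  apply: eq_card => b; rewrite !inE; apply: andb_idl => /andP[Rb ob].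
  move: Rb; rewrite (o9_formE ob) real_line_pair_o9 => /andP[_].
  exact: o9_conic_neq0.
rewrite card_o9_split -(cardsC1 (0 : F)) -cardsT -!cardsX; congr (_ + _)%N.
  (* For u = 0: v = 0, w is nonzero and z is free. *)
  rewrite -(card_imset _ (_ : injective (fun p : F * F => (0 : F, p.1, p.2))));
    last first.
    by move=> [? ?] [? ?] [-> ->].
  apply: eq_card => -[[v w] z]; rewrite inE real_line_pair_o9 /= !mul0r expr0n
    mulr0.
  rewrite add0r subr0 expf_eq0 eqxx /=.
  apply/andP/imsetP => [[/eqP-> w0]|[[w' z']]].
    by exists (w, z); rewrite // !inE andbT; move: w0; rewrite eqxx.
  by rewrite !inE andbT /= => w0 [-> -> _]; rewrite eqxx.
(* For u nonzero: v and w are free and z is the unique root of the discriminant. *)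
rewrite -(card_imset _ (_ : injective (fun p : F * F * F =>
  (p, (p.1.1 * p.1.2 * p.2 + p.1.2 ^+ 3) / p.1.1 ^+ 2)))); last first.
  by move=> ? ? [].
apply: eq_card => -[[[u v] w] z]; rewrite inE real_line_pair_o9 /=.
apply/and3P/imsetP => [[u0 e _]|[[[u' v'] w']]].
  exists (u, v, w); first by rewrite !inE u0.
  by move: e; rewrite subr_eq0 => /eqP /= ->; rewrite mulfK // expf_neq0.
rewrite !inE !andbT /= => u0 [-> -> -> ->].
by split=> //; [rewrite divfK ?subrr ?expf_neq0 | rewrite (negPf u0)].
Qed.

Lemma card_nonsingular_o9 :
  #|[set b : 'rV[F]_6 | [&& b != 0, nonsingular_conic b & o9_form b]]| =
  (q.-1 * q * q + q.-1 * q * q * q.-1)%N.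
Proof.
transitivity #|[set b : 'rV[F]_6 | nonsingular_conic b && o9_form b]|.
  apply: eq_card => b; rewrite !inE; apply: andb_idl => /andP[Nb _].
  apply: contra Nb => /eqP ->; rewrite conic_discE /= !mxE; apply/eqP; ring.
rewrite card_o9_split /nonsingular_conic -(cardsC1 (0 : F)) -cardsT -!cardsX.
congr (_ + _)%N.
  (* For u = 0 the discriminant is v^3: v is nonzero, w and z are free. *)
  apply: eq_card => -[[v w] z]; rewrite !inE disc_o9_conic /= !mul0r expr0n
    mulr0.
  by rewrite add0r subr0 expf_eq0 /= !andbT.
(* For u nonzero, z avoids the root of the discriminant; the last parameter is the nonzero
   difference between that root and z. *)
rewrite -[RHS](card_imset _ (_ : injective (fun p : F * F * F * F =>
  (p.1, (p.1.1.1 * p.1.1.2 * p.1.2 + p.1.1.2 ^+ 3) / p.1.1.1 ^+ 2 - p.2)))).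
  apply: eq_card => -[[[u v] w] z]; rewrite inE disc_o9_conic /=.
  apply/andP/imsetP => [[u0 e]|[[[[u' v'] w'] e]]].
    exists (u, v, w, (u * v * w + v ^+ 3) / u ^+ 2 - z);
      last by rewrite /= subKr.
    rewrite !inE u0 /=; apply: contra e.
    by rewrite subr_eq0 => /eqP <-; rewrite divfK ?subrr ?expf_neq0.
  rewrite !inE !andbT /= => /andP[u0 e0] [-> -> -> ->]; split=> //.
  by rewrite mulrBl divfK ?expf_neq0 // subKr mulf_neq0 ?expf_neq0.
by move=> [p e] [p' e'] [<- /addrI/oppr_inj <-].
Qed.

End Cards.

(** * The distribution, by cancelling q - 1 from the four counts *)

Theorem lemma4p7 (q : nat) (F E : finFieldType) (iota : {rmorphism F -> E})
    (hF : #|F| = q) (hE : #|E| = (q ^ 2)%N)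
    (L : {set {set 'rV[F]_6}}) (hL : L \in o9 F) :
  OD4 iota L = [:: 1; q ^ 2 + q; 0; q ^ 3]%N.
Proof.
have q_gt1 : (1 < q)%N by rewrite -hF finNzRing_gt1.
have q1 : (0 < q.-1)%N by rewrite -ltnS prednK // ltnW.
(* Writing q as a successor removes the truncated predecessor, so that [ring] can compare the
   counts. *)
have [r qE] : exists r, q = r.+1 by exists q.-1; rewrite prednK // ltnW.
rewrite /OD4; congr [:: _; _; _; _]; apply/eqP; rewrite -(eqn_pmul2r q1) -{1}hF.
- rewrite hyperplanes_through_o9 //; first by rewrite card_double_o9 hF mul1n.
  + by move=> A a _; apply: double_line_act.
  + by move=> k a _; apply: double_lineZ.
- rewrite hyperplanes_through_o9 //.
  + by rewrite card_real_o9 hF qE /= expnS expn1; apply/eqP; ring.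
  + exact: real_line_pair_act.
  + exact: real_line_pairZ.
- rewrite hyperplanes_through_o9 //.
  + rewrite mul0n cards_eq0; apply/eqP/setP => b; rewrite !inE.
    apply/negP => /and3P[b0 Ib /o9_formE e]; move: b0 Ib; rewrite e => b0.
    by rewrite imaginary_line_pair_o9.
  + exact: imaginary_line_pair_act.
  + by move=> k a _; apply: imaginary_line_pairZ.
rewrite hyperplanes_through_o9 //.
- by rewrite card_nonsingular_o9 hF qE /= !expnS expn0; apply/eqP; ring.
- exact: nonsingular_conic_act.
- exact: nonsingular_conicZ.
Qed.
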